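(* Fix $\beta\in(0,1)$. Then the stationary Markov policy $u\in\Pi'$ is (risk-averse) moment optimal for the $\beta$-discounted reward if and only if there exists $\gamma_\beta<0$ such that $u\in\Pi^*(\beta,\gamma)$ for all $\gamma\in[\gamma_\beta,0]$.
   Context: Setting (finite discounted risk-sensitive MDP). $E=\{x_1,\dots,x_k\}$ is a finite state space and $U=\{\tilde u_1,\dots,\tilde u_l\}$ a finite action space (both nonempty); every action is available in every state. For $a\in U$, $P^a=[p_a(x_i,x_j)]_{i,j=1}^k$ is a transition probability matrix. $c\colon E\times U\to\mathbb{R}$ is a fixed running reward. $(X_n)_{n\ge 0}$ is the canonical state process. A policy is a sequence $\pi=(a_n)_{n\ge0}$, where $a_n$ is a $U$-valued function of $(X_0,\dots,X_n)$; $\Pi$ is the set of all policies. $\mathbb{E}_x^\pi$ is the expectation under the law of the process with $X_0=x$ and $\mathbb{P}(X_{n+1}=y\mid X_0,\dots,X_n)=p_{a_n}(X_n,y)$. $\Pi''\subset\Pi$ is the set of Markov policies, identified with sequences $(u_n)_{n\ge0}$, $u_n\colon E\to U$, via $a_n=u_n(X_n)$. $\Pi'\subset\Pi''$ is the set of stationary Markov policies, identified with functions $u\colon E\to U$, via $a_n=u(X_n)$ for all $n$. For $\gamma\in\mathbb{R}$, $\beta\in(0,1)$, $x\in E$, $\pi=(a_i)_{i\ge 0}\in\Pi$, put $$J_\gamma(x,\pi;\beta):=\begin{cases}\frac1\gamma\ln\mathbb{E}_x^\pi\big[e^{\gamma\sum_{i=0}^\infty\beta^i c(X_i,a_i)}\big],&\gamma\ne0,\\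 \mathbb{E}_x^\pi\big[\sum_{i=0}^\infty\beta^i c(X_i,a_i)\big],&\gamma=0.\end{cases}$$ $\Pi^*(\beta,\gamma)$ is the set of Markov policies $\pi\in\Pi''$ that are optimal for every starting point, i.e. $J_\gamma(x,\pi;\beta)=\sup_{\pi'\in\Pi}J_\gamma(x,\pi';\beta)$ for all $x\in E$. Moment optimality: with $Z:=\sum_{i=0}^\infty\beta^ic(X_i,a_i)$ (the actions $a_i$ being those of the policy under which the expectation is taken), a policy $\pi\in\Pi$ is (risk-averse) moment optimal for the $\beta$-discounted reward if for any $\pi'\in\Pi$ and $x\in E$, either $\mathbb{E}_x^\pi[Z^k]=\mathbb{E}_x^{\pi'}[Z^k]$ for all $k\ge1$, or there exists $n\in\{1,2,\dots\}$ such that $$(-1)^{k+1}\mathbb{E}_x^\pi[Z^k]=(-1)^{k+1}\mathbb{E}_x^{\pi'}[Z^k]\ \text{ for }k=1,\dots,n-1,\qquad(-1)^{n+1}\mathbb{E}_x^\pi[Z^n]>(-1)^{n+1}\mathbb{E}_x^{\pi'}[Z^n]$$ (for $n=1$ the first condition is vacuous). *)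

(* Defs.v *)
From HB Require Import structures.
From mathcomp Require Import all_boot all_order all_algebra.
From mathcomp Require Import all_classical all_reals all_analysis.

Set Implicit Arguments.
Unset Strict Implicit.
Unset Printing Implicit Defensive.

Import Order.TTheory GRing.Theory Num.Theory.
Import numFieldNormedType.Exports.
Local Open Scope classical_set_scope.
Local Open Scope ring_scope.

(* States 'I_k.+1 and actions 'I_l.+1: arbitrary finite nonempty sets,
   enumerated. *)
Record mdp (R : realType) (k l : nat) := MDP {
  trans : 'I_l.+1 -> 'M[R]_k.+1 ;
  reward : 'I_k.+1 -> 'I_l.+1 -> R ;
  trans_ge0 : forall a x y, 0 <= trans a x y ;
  trans_sum1 : forall a x, \sum_y trans a x y = 1 }.

(* `pi n h` is the action taken at time n after the states `h` = (X_0, ..., X_n). *)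
Definition policy (k l : nat) := forall n : nat, n.+1.-tuple 'I_k.+1 -> 'I_l.+1.

Definition markov k l (v : nat -> 'I_k.+1 -> 'I_l.+1) : policy k l :=
  fun n h => v n (tnth h ord_max).

Definition stationary k l (u : 'I_k.+1 -> 'I_l.+1) : policy k l :=
  markov (fun=> u).

Definition is_markov k l : set (policy k l) := range (@markov k l).

Definition coordinate_events k : set (set (nat -> 'I_k.+1)) :=
  [set A | exists n y, A = [set w | w n = y]].

HB.instance Definition _ k := isPointed.Build 'I_k.+1 ord0.
HB.instance Definition _ k := Pointed.on (nat -> 'I_k.+1).

(* Sequences of states with the product sigma-algebra: the canonical state
   process is X_n(w) = w n. *)
Definition trajectory k := g_sigma_algebraType (@coordinate_events k).
HB.instance Definition _ k := Measurable.on (trajectory k).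

Definition history k (w : trajectory k) (n : nat) : n.+1.-tuple 'I_k.+1 :=
  [tuple w i | i < n.+1].

Definition action k l (pi : policy k l) (w : trajectory k) (n : nat) : 'I_l.+1 :=
  pi n (history w n).

(* The transition rule P(X_{n+1} = y | X_0, ..., X_n) = p_{a_n}(X_n, y), multiplied
   out so that histories of probability zero need no special treatment. *)
Definition is_law (R : realType) k l (M : mdp R k l) (x : 'I_k.+1)
    (pi : policy k l) (P : probability (trajectory k) R) : Prop :=
  P [set w | w 0%N = x] = 1%E /\
  forall n (h : n.+1.-tuple 'I_k.+1) (y : 'I_k.+1),
    P [set w | history w n = h /\ w n.+1 = y] =
    (P [set w | history w n = h] *
      (trans M (pi n h) (tnth h ord_max) y)%:E)%E.

(* The law of the process is realised on [0, 1[ with Lebesgue measure: `cell h`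
   is the half-open interval of the points whose path starts with `rev h`; it
   is cut into consecutive cells of lengths proportional to `q h`. *)
Section path_law.
Context (R : realType) (k : nat).
Variable q : seq 'I_k.+1 -> 'I_k.+1 -> R.
Hypothesis q_ge0 : forall h y, 0 <= q h y.
Hypothesis q_sum1 : forall h, \sum_y q h y = 1.

Let cum h (m : nat) : R := \sum_(z < k.+1 | (z < m)%N) q h z.

Fixpoint cell_len (h : seq 'I_k.+1) : R :=
  if h is y :: h' then cell_len h' * q h' y else 1.

Fixpoint cell_left (h : seq 'I_k.+1) : R :=
  if h is y :: h' then cell_left h' + cell_len h' * cum h' y else 0.

Let cell h : set R := `[cell_left h, cell_left h + cell_len h[.

Let cell_len_ge0 h : 0 <= cell_len h.
Proof. by elim: h => //= y h IH; rewrite mulr_ge0. Qed.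

Let cumS h (y : 'I_k.+1) : cum h y.+1 = cum h y + q h y.
Proof.
rewrite /cum (bigD1 y) ?ltnS//= addrC; congr (_ + _).
by apply: eq_bigl => z; rewrite ltnS ltn_neqAle andbC.
Qed.

Let cum0 h : cum h 0 = 0.
Proof. by rewrite /cum big_pred0. Qed.

Let cumT h : cum h k.+1 = 1.
Proof.
by rewrite -(q_sum1 h) /cum; apply: eq_bigl => z; rewrite ltn_ord.
Qed.

Let cum_homo h m n : (m <= n)%N -> cum h m <= cum h n.
Proof.
move=> mn; rewrite /cum [leRHS](bigID (fun z : 'I_k.+1 => (z < m)%N))/=.
rewrite [X in _ <= X + _](eq_bigl (fun z : 'I_k.+1 => (z < m)%N)); last first.
  move=> z /=; have [zm|mz] := ltnP z m; last by rewrite andbF.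
  by rewrite andbT (leq_trans zm mn).
by rewrite lerDl sumr_ge0.
Qed.

Let in_cell t y h : cell (y :: h) t <->
  cell_left h + cell_len h * cum h y <= t /\
  t < cell_left h + cell_len h * cum h y.+1.
Proof.
rewrite /cell /= in_itv/= cumS mulrDr addrA.
by split=> [/andP[]|[-> ->]].
Qed.

Let cell_cons t y h : cell (y :: h) t -> cell h t.
Proof.
move=> /in_cell[a b]; rewrite /cell/= in_itv/=; apply/andP; split.
  apply: le_trans a; rewrite lerDl mulr_ge0// -(cum0 h).
  exact: cum_homo.
apply: (lt_le_trans b); rewrite lerD2l ler_piMr// -(cumT h).
by apply: cum_homo; exact: ltn_ord.
Qed.

Let cell_next t h : cell h t -> exists y, cell (y :: h) t.
Proof.
rewrite /cell/= in_itv/= => /andP[a b].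
pose Q m := t < cell_left h + cell_len h * cum h m.
have exQ : exists m, Q m by exists k.+1; rewrite /Q cumT mulr1.
case: (ex_minnP exQ) => m Qm minm.
have m_gt0 : (0 < m)%N.
  rewrite lt0n; apply/eqP => m0; move: Qm.
  by rewrite m0 /Q cum0 mulr0 addr0 ltNge a.
have mk : (m.-1 < k.+1)%N.
  by rewrite prednK//; apply: minm; rewrite /Q cumT mulr1.
exists (Ordinal mk); apply/in_cell => /=; rewrite prednK//; split => //.
rewrite leNgt; apply/negP => /minm.
by rewrite -{1}(prednK m_gt0) ltnn.
Qed.

Let cell_uniq t h y z : cell (y :: h) t -> cell (z :: h) t -> y = z.
Proof.
wlog yz : y z / (y <= z)%N.
  move=> H cy cz; case: (leqP y z) => [|/ltnW] /H; first by apply.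
  by move=> /(_ cz cy).
move=> /in_cell[_ b] /in_cell[c _].
apply/val_inj/eqP; rewrite eqn_leq yz leqNgt; apply/negP => yz'.
suff : t < t by rewrite ltxx.
apply: (lt_le_trans b); apply: le_trans c; rewrite lerD2l ler_wpM2l//.
exact: cum_homo.
Qed.

Let next t h : 'I_k.+1 := odflt ord0 [pick y | `[< cell (y :: h) t >]].

Let nextP t h y : cell h t -> next t h = y <-> cell (y :: h) t.
Proof.
move=> ht; rewrite /next; case: pickP => [z /asboolP zt|].
  by split=> [<-//|/(cell_uniq zt)].
by have [z zt] := cell_next ht; move=> /(_ z) /asboolPn.
Qed.

Let rpath t := fix rp n := if n is m.+1 then next t (rp m) :: rp m else [::].

Let unit_itv : set R := `[0, 1[.

Let cell_nil : cell [::] = unit_itv.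
Proof. by rewrite /cell /unit_itv/= add0r. Qed.

Let rpath_cell t n : unit_itv t -> cell (rpath t n) t.
Proof.
move=> t01; elim: n => [|n IH] /=; first by rewrite cell_nil.
exact/nextP.
Qed.

Let rpathP t h : unit_itv t -> rpath t (size h) = h <-> cell h t.
Proof.
move=> t01; elim: h => [|y h IH]; first by rewrite cell_nil.
split=> [<-|yht]; first exact: rpath_cell.
have ht := cell_cons yht; rewrite /= ((IH.2 ht)).
by rewrite ((nextP y ht).2 yht).
Qed.

Let sample (t : measurableTypeR R) : trajectory k :=
  fun n => if t \in unit_itv then next t (rpath t n) else ord0.

Let rpath_sample t n : unit_itv t ->
  rpath t n.+1 = rev (history (sample t) n).
Proof.
move=> t01; have -> : rpath t n.+1 = rev (mkseq (sample t) n.+1).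
  elim: n => [|n IH]; first by rewrite /= /mkseq/= /sample mem_set.
  by rewrite mkseqS rev_rcons -IH [in RHS]/sample mem_set.
congr rev; rewrite /history/= /mkseq -val_enum_ord -map_comp.
by apply: eq_map.
Qed.

Let measurable_cell h : measurable (cell h : set (measurableTypeR R)).
Proof. exact: measurable_itv. Qed.

Let measurable_unit_itv : measurable (unit_itv : set (measurableTypeR R)).
Proof. exact: measurable_itv. Qed.

Let sample_hist n (h : n.+1.-tuple 'I_k.+1) :
  unit_itv `&` sample @^-1` [set w | history w n = h] = cell (rev h).
Proof.
apply/seteqP; split=> t /=.
  move=> [t01 th]; apply/rpathP => //; rewrite size_rev size_tuple.
  by rewrite rpath_sample// th.
move=> ht; have t01 : unit_itv t.
  rewrite -cell_nil; elim: (rev h) ht => // y s IH /cell_cons; exact: IH.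
split=> //; move/(rpathP _ t01) : ht.
rewrite size_rev size_tuple rpath_sample// => /(congr1 rev).
by rewrite !revK => /val_inj.
Qed.

Let historyE (w : trajectory k) n : w n = tnth (history w n) ord_max.
Proof. by rewrite tnth_mktuple. Qed.

Let measurable_sample : measurable_fun setT sample.
Proof.
refine (@measurability _ _ _ (trajectory k) setT sample (@coordinate_events k) erefl _).
move=> _ [_ [n [y ->]] <-]; rewrite setTI.
rewrite -(setIT (sample @^-1` _)) -(setUv unit_itv) setIUr.
apply: measurableU.
  rewrite setIC; have -> : unit_itv `&` sample @^-1` [set w | w n = y] =
    \bigcup_(h in [set h : n.+1.-tuple 'I_k.+1 | tnth h ord_max = y])
       (unit_itv `&` sample @^-1` [set w | history w n = h]).
    apply/seteqP; split=> t /=.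
      move=> [t01 ty]; exists (history (sample t) n) => //=.
      by rewrite -historyE.
    by move=> [h <- [t01 <-]]; split=> //; rewrite -historyE.
  apply: fin_bigcup_measurable => // h _.
  by rewrite sample_hist; exact: measurable_cell.
have [->|yn0] := eqVneq y ord0.
  rewrite (_ : _ `&` _ = ~` unit_itv); first exact: measurableC.
  apply/seteqP; split=> t; first by case.
  by move=> tn; split=> //; rewrite /preimage/= /sample memNset.
rewrite (_ : _ `&` _ = set0)//; apply/seteqP; split=> t // [].
rewrite /preimage/= /sample => /[swap] tn; rewrite memNset// => /eqP.
by rewrite eq_sym (negbTE yn0).
Qed.

Definition path_prob (A : set (trajectory k)) : \bar R :=
  lebesgue_measure (unit_itv `&` sample @^-1` A).

Let path_prob_hist n (h : n.+1.-tuple 'I_k.+1) :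
  path_prob [set w | history w n = h] = (cell_len (rev h))%:E.
Proof.
rewrite /path_prob sample_hist /cell lebesgue_measure_itv/= lte_fin.
rewrite ltrDl -EFinB addrAC subrr add0r; case: ltP => //.
by move=> len_le0; congr EFin; apply/eqP; rewrite eq_le cell_len_ge0.
Qed.

Let mu1 : {measure set measurableTypeR R -> \bar R} := mrestr (@lebesgue_measure R) measurable_unit_itv.

Let mu0E : path_prob = pushforward mu1 sample.
Proof. by apply/funext => A; rewrite /path_prob /pushforward /mu1 /mrestr setIC. Qed.

Let mu0_0 : path_prob set0 = 0%E.
Proof. by rewrite mu0E /pushforward preimage_set0 measure0. Qed.

Let mu0_ge0 A : (0 <= path_prob A)%E.
Proof. by rewrite mu0E; exact: measure_ge0. Qed.

Let mu0_sigma_additive : semi_sigma_additive path_prob.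
Proof.
move=> F mF tF mUF; rewrite mu0E /pushforward preimage_bigcup.
apply: measure_semi_sigma_additive.
- by move=> n; rewrite -[X in measurable X]setTI; exact: measurable_sample.
- apply/trivIsetP => /= i j _ _ ij; rewrite -preimage_setI.
  by move/trivIsetP : tF => /(_ _ _ _ _ ij) ->//; rewrite preimage_set0.
- rewrite -preimage_bigcup -[X in measurable X]setTI.
  exact: measurable_sample.
Qed.

HB.instance Definition _ :=
  isMeasure.Build _ _ _ path_prob mu0_0 mu0_ge0 mu0_sigma_additive.

Let mu0_setT : path_prob setT = 1%E.
Proof.
by rewrite /path_prob preimage_setT setIT lebesgue_measure_itv/= lte01 sube0.
Qed.

HB.instance Definition _ := Measure_isProbability.Build _ _ _ path_prob mu0_setT.

Lemma path_law_exists : exists P : probability (trajectory k) R,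
  forall n (h : n.+1.-tuple 'I_k.+1),
    P [set w | history w n = h] = (cell_len (rev h))%:E.
Proof. by exists path_prob => n h; exact: path_prob_hist. Qed.

End path_law.

(* `h` lists the states visited so far, the latest one first *)
Definition step (R : realType) k l (M : mdp R k l) (x : 'I_k.+1) (pi : policy k l)
    (h : seq 'I_k.+1) (y : 'I_k.+1) : R :=
  if h is z :: h' then
    trans M (pi (size h') [tuple nth ord0 (rev h) i | i < (size h').+1]) z y
  else (y == x)%:R.

Lemma law_exists (R : realType) k l (M : mdp R k l) (x : 'I_k.+1)
  (pi : policy k l) : exists P, is_law M x pi P.
Proof.
have step_ge0 h y : 0 <= step M x pi h y.
  by case: h => [|z h] /=; [exact: ler0n | exact: trans_ge0].
have step_sum1 h : \sum_y step M x pi h y = 1.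
  case: h => [|z h] /=; last exact: trans_sum1.
  by rewrite (bigD1 x)//= eqxx big1 ?addr0// => y /negPf ->.
have [P HP] := path_law_exists step_ge0 step_sum1.
exists P; split=> [|n h y].
  rewrite (_ : [set w | _] = [set w | history w 0 = [tuple x]]).
    by rewrite HP /= eqxx mul1r.
  apply/seteqP; split=> w /=.
    by move=> wx; apply/val_inj; rewrite /= enum_ordSl/= enum_ord0/= wx.
  by move=> /(congr1 (fun t => tnth t ord0)); rewrite tnth_mktuple.
rewrite (_ : [set w | _ /\ _] = [set w | history w n.+1 = [tuple of rcons h y]]).
  rewrite !HP /= rev_rcons /= EFinM; congr (_ * _%:E)%E.
  have size_h : size (rev h) = n.+1 by rewrite size_rev size_tuple.
  have last_h : nth ord0 (rev h) 0 = tnth h ord_max.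
    by rewrite (tnth_nth ord0) nth_rev size_tuple ?subSS ?subn0.
  rewrite /step; case E : (rev h) size_h last_h => [//|z h'] /= [size_h'] <-.
  subst n; congr (trans M (pi _ _) _ _); apply: eq_from_tnth => i.
  by rewrite tnth_mktuple (tnth_nth ord0) -E revK.
have histS w : history w n.+1 = rcons (history w n) (w n.+1) :> seq _.
  have mkE m : history w m = mkseq w m.+1 :> seq _.
    rewrite /= /mkseq -val_enum_ord -map_comp; exact: eq_map.
  by rewrite !mkE mkseqS.
apply/seteqP; split=> w /= => [[wh wy]|wh].
  by apply/val_inj; rewrite [LHS]histS wh wy.
have /rcons_inj[hh ->] : rcons (history w n) (w n.+1) = rcons h y.
  by rewrite -[LHS]histS wh.
by split=> //; exact: val_inj.
Qed.

(* E_x^pi: `is_law` determines the law uniquely, since the events fixing a finite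
   history generate the sigma-algebra and are stable under intersection. *)
Definition law (R : realType) k l (M : mdp R k l) (x : 'I_k.+1)
    (pi : policy k l) : probability (trajectory k) R :=
  projT1 (cid (law_exists M x pi)).

Lemma lawP (R : realType) k l (M : mdp R k l) x (pi : policy k l) :
  is_law M x pi (law M x pi).
Proof. exact: projT2 (cid (law_exists M x pi)). Qed.

(* Only used on bounded random variables, where `fine` loses nothing. *)
Definition expect (R : realType) k l (M : mdp R k l) (x : 'I_k.+1)
    (pi : policy k l) (f : trajectory k -> R) : R :=
  fine 'E_(law M x pi)[f].

Definition discounted_reward (R : realType) k l (M : mdp R k l) (beta : R)
    (pi : policy k l) (w : trajectory k) : R :=
  limn (series (fun i => beta ^+ i * reward M (w i) (action pi w i))).

Definition J (R : realType) k l (M : mdp R k l) (gamma : R) (x : 'I_k.+1)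
    (pi : policy k l) (beta : R) : R :=
  if gamma == 0 then expect M x pi (discounted_reward M beta pi)
  else gamma^-1 *
    ln (expect M x pi (fun w => expR (gamma * discounted_reward M beta pi w))).

(* Pi^*(beta, gamma) *)
Definition optimal_markov (R : realType) k l (M : mdp R k l) (beta gamma : R) :
    set (policy k l) :=
  [set pi | @is_markov k l pi /\ forall x,
    (J M gamma x pi beta)%:E =
      ereal_sup [set (J M gamma x pi' beta)%:E | pi' in [set: policy k l]]].

Definition moment (R : realType) k l (M : mdp R k l) (beta : R) (x : 'I_k.+1)
    (pi : policy k l) (j : nat) : R :=
  expect M x pi (fun w => discounted_reward M beta pi w ^+ j).

Definition moment_optimal (R : realType) k l (M : mdp R k l) (beta : R)
    (pi : policy k l) : Prop :=
  forall (pi' : policy k l) (x : 'I_k.+1),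
    (forall j, (1 <= j)%N -> moment M beta x pi j = moment M beta x pi' j) \/
    exists n, [/\ (1 <= n)%N,
      forall j, (1 <= j < n)%N ->
        (-1) ^+ j.+1 * moment M beta x pi j =
        (-1) ^+ j.+1 * moment M beta x pi' j &
      (-1) ^+ n.+1 * moment M beta x pi n >
      (-1) ^+ n.+1 * moment M beta x pi' n].

(* Main.v *)
Require Import Defs.
From mathcomp Require Import all_boot all_order all_algebra.
From mathcomp Require Import all_classical all_reals all_analysis.
From mathcomp Require Import measurable_realfun ring lra.

Set Implicit Arguments.
Unset Strict Implicit.
Unset Printing Implicit Defensive.

Import Order.TTheory GRing.Theory Num.Theory.
Import numFieldNormedType.Exports.
Local Open Scope classical_set_scope.
Local Open Scope ring_scope.

(** For a stationary policy u write phi_gamma(x) for the exponential moment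
    E_x^u[exp(gamma Z)]. Two facts carry the proof.

    Local comparison. Z is bounded, so exponential moments are approximated near
    gamma = 0 by their Taylor polynomials, whose coefficients are the moments of
    Z ([mgf_taylor]). Hence, for small gamma < 0, the exponential moments of two
    policies from the same state are ordered by the first moment in which the
    policies differ, with sign (-1)^n; and they coincide if all the moments do
    ([mgf_lt_near0], [mgf_eq_near0]). Since J_gamma is a decreasing function of
    the exponential moment when gamma < 0, a policy that beats every other one
    for all small gamma < 0 is moment optimal.

    Uniformity. The converse needs one interval of gamma that serves all the
    competing policies, whereas the local comparison yields an interval for each
    of them. It suffices to compare u with its one-step deviations, which play a
    fixed action a at time 0 and u afterwards: there are finitely many, so they
    share an interval [-e, 0). By the first-step equation [mgf_markov] the
    deviation has exponential moment
    exp(gamma c(x,a)) sum_y p_a(x,y) phi_(gamma beta)(y), so that on [-e, 0) the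
    function phi is a subsolution of the risk-sensitive optimality equation. The
    points gamma beta^n all stay in [-e, 0), and iterating the inequality along
    an arbitrary policy bounds phi_gamma(x) by
    E[exp(gamma Z_n) phi_(gamma beta^n)(X_n)] for the partial sums Z_n, which
    tends to the exponential moment of that policy ([bellman_verification]). *)

(** * Bounded random variables *)

(** The class of random variables in which the whole proof takes place: it is
    closed under sums, products and exponentials, and its members are integrable
    for every probability. *)
Definition bounded_rv d (T : measurableType d) (R : realType) (f : T -> R) :=
  measurable_fun setT f /\ exists B, forall w, `|f w| <= B.

Section bounded_rv.
Context d (T : measurableType d) (R : realType) (P : probability T R).
Implicit Types f g : T -> R.

Lemma bounded_rv_integrable f : bounded_rv f -> P.-integrable setT (EFin \o f).
Proof.
move=> [mf [B fB]]; apply: measurable_bounded_integrable => //.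
  by rewrite [X in (X < _)%E](probability_setT P) ltry.
exists B; split; first exact: num_real.
by move=> C BC w _; apply: le_trans (ltW BC); exact: fB.
Qed.

Lemma bounded_rv_cst (r : R) : bounded_rv (fun _ : T => r).
Proof. by split; [exact: measurable_cst | exists `|r|]. Qed.

Lemma bounded_rvD f g :
  bounded_rv f -> bounded_rv g -> bounded_rv (fun w => f w + g w).
Proof.
move=> [mf [B fB]] [mg [C gC]]; split; first exact: measurable_funD.
by exists (B + C) => w; rewrite (le_trans (ler_normD _ _))// lerD.
Qed.

Lemma bounded_rvM f g :
  bounded_rv f -> bounded_rv g -> bounded_rv (fun w => f w * g w).
Proof.
move=> [mf [B fB]] [mg [C gC]]; split; first exact: measurable_funM.
by exists (B * C) => w; rewrite normrM ler_pM.
Qed.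

Lemma bounded_rvX f n : bounded_rv f -> bounded_rv (fun w => f w ^+ n).
Proof.
move=> [mf [B fB]]; split; first exact: measurable_funX.
by exists (B ^+ n) => w; rewrite normrX lerXn2r// nnegrE (le_trans _ (fB w)).
Qed.

Lemma bounded_rv_expR f : bounded_rv f -> bounded_rv (fun w => expR (f w)).
Proof.
move=> [mf [B fB]]; split; first exact: measurableT_comp.
exists (expR B) => w; rewrite ger0_norm ?expR_ge0// ler_expR.
exact: le_trans (ler_norm _) (fB w).
Qed.

Lemma bounded_rv_sum (I : Type) (s : seq I) (f : I -> T -> R) :
  (forall i, bounded_rv (f i)) -> bounded_rv (fun w => \sum_(i <- s) f i w).
Proof.
move=> bf; elim: s => [|i s IH].
  by under eq_fun do rewrite big_nil; exact: bounded_rv_cst.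
by under eq_fun do rewrite big_cons; exact: bounded_rvD.
Qed.

Lemma Rintegral_bounded_sum (I : Type) (s : seq I) (f : I -> T -> R) :
  (forall i, bounded_rv (f i)) ->
  \int[P]_w (\sum_(i <- s) f i w) = \sum_(i <- s) \int[P]_w f i w.
Proof.
move=> bf; elim: s => [|i s IH].
  under eq_Rintegral do rewrite big_nil.
  by rewrite Rintegral_cst// mul0r big_nil.
under eq_Rintegral do rewrite big_cons.
rewrite RintegralD ?IH ?big_cons//; first exact: bounded_rv_integrable.
exact/bounded_rv_integrable/bounded_rv_sum.
Qed.

Lemma ler_Rintegral f g : bounded_rv f -> bounded_rv g ->
  (forall w, f w <= g w) -> \int[P]_w f w <= \int[P]_w g w.
Proof. by move=> bf bg fg; apply: le_Rintegral => //; exact: bounded_rv_integrable. Qed.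

Lemma Rintegral_probability_cst (r : R) : \int[P]_w r = r.
Proof.
by rewrite Rintegral_cst// [X in fine X](probability_setT P) mulr1.
Qed.

Lemma Rintegral_dist_le f g e : bounded_rv f -> bounded_rv g ->
  (forall w, `|f w - g w| <= e) ->
  `|\int[P]_w f w - \int[P]_w g w| <= e.
Proof.
move=> bf bg fge.
have iB r : P.-integrable setT (EFin \o (fun _ : T => r)).
  exact/bounded_rv_integrable/bounded_rv_cst.
have [ifP igP] := (bounded_rv_integrable bf, bounded_rv_integrable bg).
have bN (h : T -> R) : bounded_rv h -> bounded_rv (fun w => h w - e).
  by move=> bh; apply: bounded_rvD => //; exact: bounded_rv_cst.
rewrite ler_distl -{1 2}(Rintegral_probability_cst e).
rewrite -RintegralB// -RintegralD//; apply/andP; split.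
  apply: ler_Rintegral => // [|w]; first exact: bN.
  by have := fge w; rewrite ler_distl => /andP[].
apply: ler_Rintegral => // [|w].
  by apply: bounded_rvD => //; exact: bounded_rv_cst.
by have := fge w; rewrite ler_distl => /andP[].
Qed.

Lemma Rintegral_indic (A : set T) : measurable A ->
  \int[P]_w (\1_A w) = fine (P A).
Proof. by move=> mA; rewrite /Rintegral integral_indic// setIT. Qed.

Lemma bounded_rv_indic (A : set T) : measurable A ->
  bounded_rv (\1_A : T -> R).
Proof.
move=> mA; split; first exact: measurable_indic.
by exists 1 => w; rewrite indicE ger0_norm; case: (_ \in _) => /=; rewrite ?ler01.
Qed.

End bounded_rv.

(** * Partial sums and tails *)

(** Common to the two tails used below, that of the exponential series and that
    of the discounted reward. *)
Lemma lim_series_dist_le (R : realType) (u : nat -> R) n b :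
  cvgn (series u) ->
  (forall m, (n <= m)%N -> `|\sum_(n <= j < m) u j| <= b) ->
  `|limn (series u) - series u n| <= b.
Proof.
move=> cu ub; rewrite ler_distl; apply/andP; split.
  apply: limr_ge => //; near=> m.
  have nm : (n <= m)%N by near: m; exists n.
  by have := ub m nm; rewrite -sub_series_geq// ler_norml; lra.
apply: limr_le => //; near=> m.
have nm : (n <= m)%N by near: m; exists n.
by have := ub m nm; rewrite -sub_series_geq// ler_norml; lra.
Unshelve. all: by end_near. Qed.

(** The term of index n + j is at most |t|^n |t|^j / j!, because (n + j)! >= j!.
    The bound is cruder than Lagrange's by a factor n!, but it is still of order
    |t|^n at 0, and for |t| < 1 it tends to 0 with n. *)
Lemma expR_taylor (R : realType) (t : R) n :
  `|expR t - \sum_(0 <= j < n) t ^+ j / j`!%:R| <= `|t| ^+ n * expR `|t|.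
Proof.
apply: lim_series_dist_le (is_cvg_series_exp_coeff t) _ => m nm.
apply: le_trans (ler_norm_sum _ _ _) _.
rewrite -{1}(add0n n) big_addn.
apply: le_trans (_ : \sum_(0 <= j < m - n) `|t| ^+ n * exp_coeff `|t| j <= _).
  apply: ler_sum => j _; rewrite /exp_coeff /= exprD normrM normfV normrM.
  rewrite !normrX [X in _ / X]ger0_norm// mulrAC [leLHS]mulrC.
  rewrite ler_wpM2l ?exprn_ge0// ler_wpM2l ?exprn_ge0//.
  by rewrite lef_pV2 ?posrE ?ltr0n ?fact_gt0// ler_nat leq_fact// leq_addr.
rewrite -mulr_sumr ler_wpM2l ?exprn_ge0//.
have /nondecreasing_cvgn_le := nondecreasing_series (P := xpredT) (m := 0)
  (fun j (_ : (0 <= j)%N) (_ : true) => exp_coeff_ge0 j (normr_ge0 t)).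
by move=> /(_ (is_cvg_series_exp_coeff _)); exact.
Qed.

(** * The controlled process *)

(** Keeping f as a function of the whole trajectory avoids conversions between
    histories of different lengths. Nothing is lost: [nth ord0 h] is the
    trajectory that follows the history h and then stays in state 0, and f is
    recovered from its values at these. *)
Definition adapted k n (S : Type) (f : trajectory k -> S) :=
  forall w w', (forall i, (i <= n)%N -> w i = w' i) -> f w = f w'.

Section history.
Variable k : nat.
Implicit Type w : trajectory k.

Lemma history_eqP w w' n :
  history w n = history w' n <-> forall i, (i <= n)%N -> w i = w' i.
Proof.
split=> [ww' i ni|ww'].
  have := congr1 (fun h => tnth h (inord i)) ww'.
  by rewrite !tnth_mktuple inordK.
by apply: eq_from_tnth => i; rewrite !tnth_mktuple ww'// -ltnS.
Qed.

Lemma nth_history w n i : (i <= n)%N -> nth ord0 (history w n) i = w i.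
Proof.
move=> ni; rewrite -[i]/(nat_of_ord (Ordinal (ni : (i < n.+1)%N))).
by rewrite -tnth_nth tnth_mktuple.
Qed.

Lemma history_nth n (h : n.+1.-tuple 'I_k.+1) :
  history (nth ord0 h : trajectory k) n = h.
Proof. by apply: eq_from_tnth => i; rewrite tnth_mktuple -tnth_nth. Qed.

Lemma tnth_history w n : tnth (history w n) ord_max = w n.
Proof. by rewrite tnth_mktuple. Qed.

Lemma measurable_coordinate n (y : 'I_k.+1) :
  measurable [set w : trajectory k | w n = y].
Proof. by apply: sub_sigma_algebra; exists n, y. Qed.

Lemma measurable_history n (h : n.+1.-tuple 'I_k.+1) :
  measurable [set w : trajectory k | history w n = h].
Proof.
rewrite (_ : [set _ | _] =
  \bigcap_(i in [set: 'I_n.+1]) [set w : trajectory k | w i = tnth h i]).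
  by apply: fin_bigcap_measurable => // i _; exact: measurable_coordinate.
apply/seteqP; split=> w /=; first by move=> <- i _ /=; rewrite tnth_mktuple.
by move=> wh; apply: eq_from_tnth => i; rewrite tnth_mktuple; exact: wh.
Qed.

Lemma adapted_history n (S : Type) (f : trajectory k -> S) w :
  adapted n f -> f (nth ord0 (history w n)) = f w.
Proof. by move=> fn; apply: fn => i ni; rewrite nth_history. Qed.

Lemma adapted_coordinate n m (S : Type) (g : 'I_k.+1 -> S) :
  (m <= n)%N -> adapted n (fun w => g (w m)).
Proof. by move=> mn w w' ww'; rewrite ww'. Qed.

Lemma adapted_action l (pi : policy k l) n : adapted n (fun w => action pi w n).
Proof. by move=> w w' /history_eqP ww'; rewrite /action ww'. Qed.

(** Finitely many histories make an adapted function a simple function, whence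
    its measurability, its boundedness, and its expectation as a finite sum. *)
Lemma adapted_indic (R : realType) n (f : trajectory k -> R) w : adapted n f ->
  f w = \sum_(h : n.+1.-tuple 'I_k.+1) f (nth ord0 h) *
    \1_[set w' : trajectory k | history w' n = h] w.
Proof.
move=> fn; rewrite (bigD1 (history w n))//= adapted_history// indicE mem_set//.
rewrite mulr1 big1 ?addr0// => h hw; rewrite indicE memNset ?mulr0// => wh.
by move: hw; rewrite -wh eqxx.
Qed.

Lemma bounded_rv_adapted (R : realType) n (f : trajectory k -> R) :
  adapted n f -> bounded_rv f.
Proof.
move=> fn; rewrite (funext (fun w => adapted_indic w fn)).
apply: bounded_rv_sum => h; apply: bounded_rvM; first exact: bounded_rv_cst.
by apply: bounded_rv_indic; exact: measurable_history.
Qed.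

End history.

Section expectation.
Variables (R : realType) (k l : nat) (M : mdp R k l).
Implicit Types (x y : 'I_k.+1) (pi : policy k l).

Lemma expectE x pi f : expect M x pi f = \int[law M x pi]_w f w.
Proof. by rewrite /expect unlock. Qed.

Lemma expect_initial x pi (g : 'I_k.+1 -> R) :
  expect M x pi (fun w => g (w 0%N)) = g x.
Proof.
have [P0 _] := lawP M x pi; rewrite expectE; set P := law M x pi in P0 *.
have Py y : y != x -> P [set w | w 0%N = y] = 0%E.
  move=> yx; apply/eqP; rewrite eq_le measure_ge0 andbT.
  have mx := measurable_coordinate 0 x.
  have <- : P (~` [set w : trajectory k | w 0%N = x]) = 0%E.
    by rewrite probability_setC// P0 subee.
  apply: le_measure; rewrite ?inE.
  - exact: measurable_coordinate.
  - exact: measurableC.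
  - by move=> w /= -> /eqP; exact/negP.
under eq_Rintegral => w _.
  rewrite (_ : g (w 0%N) =
      \sum_y g y * \1_[set w' : trajectory k | w' 0%N = y] w); first over.
  rewrite (bigD1 (w 0%N))//= indicE mem_set// mulr1 big1 ?addr0// => y yw.
  rewrite indicE memNset ?mulr0// => wy.
  by move: yw; rewrite -wy eqxx.
have bI y : bounded_rv (\1_[set w' : trajectory k | w' 0%N = y] : _ -> R).
  by apply: bounded_rv_indic; exact: measurable_coordinate.
rewrite Rintegral_bounded_sum => [|y]; last first.
  by apply: bounded_rvM => //; exact: bounded_rv_cst.
rewrite (bigD1 x)//= big1 ?addr0 => [|y yx];
  rewrite RintegralZl ?Rintegral_indic//; try exact: measurable_coordinate.
- by rewrite P0 mulr1.
- exact: bounded_rv_integrable.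
- by rewrite Py// mulr0.
- exact: bounded_rv_integrable.
Qed.

(** The Markov property: conditioning on the history up to time n replaces
    g(X_(n+1)) by its mean under the transition chosen at time n. *)
Lemma expect_step x pi n (f : trajectory k -> R) (g : 'I_k.+1 -> R) :
  adapted n f ->
  expect M x pi (fun w => f w * g (w n.+1)) =
  expect M x pi (fun w =>
    f w * \sum_y trans M (action pi w n) (w n) y * g y).
Proof.
move=> fn; have [_ Pstep] := lawP M x pi; rewrite !expectE.
set P := law M x pi in Pstep *.
pose A h y := [set w : trajectory k | history w n = h /\ w n.+1 = y].
have mA h y : measurable (A h y).
  by apply: measurableI; [exact: measurable_history|exact: measurable_coordinate].
pose F (h : n.+1.-tuple 'I_k.+1) : R := f (nth ord0 h).
transitivity (\int[P]_w (\sum_h \sum_y F h * g y * \1_(A h y) w)).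
  apply: eq_Rintegral => w _.
  rewrite (bigD1 (history w n))//= (bigD1 (w n.+1))//= /F adapted_history//.
  rewrite indicE mem_set// mulr1 !big1 ?addr0// => [h hw|y yw].
    rewrite big1// => y _; rewrite indicE memNset ?mulr0// => -[wh _].
    by move: hw; rewrite -wh eqxx.
  rewrite indicE memNset ?mulr0// => -[_ wy].
  by move: yw; rewrite -wy eqxx.
have bI h y : bounded_rv (fun w => F h * g y * \1_(A h y) w).
  by apply: bounded_rvM; [exact: bounded_rv_cst|exact: bounded_rv_indic].
rewrite Rintegral_bounded_sum => [|h]; last exact: bounded_rv_sum.
pose f' w := f w * \sum_y trans M (action pi w n) (w n) y * g y.
have f'n : adapted n f'.
  move=> w w' ww'; rewrite /f' (fn _ _ ww') (adapted_action pi ww').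
  by rewrite ww'.
rewrite [RHS](@eq_Rintegral _ _ _ _ _ (fun w => \sum_(h : n.+1.-tuple 'I_k.+1) f' (nth ord0 h) *
    \1_[set w' : trajectory k | history w' n = h] w)); last first.
  by move=> w _; exact: adapted_indic.
have bH (h : n.+1.-tuple 'I_k.+1) :
    bounded_rv (\1_[set w' : trajectory k | history w' n = h] : _ -> R).
  by apply: bounded_rv_indic; exact: measurable_history.
rewrite Rintegral_bounded_sum => [|h]; last first.
  by apply: bounded_rvM => //; exact: bounded_rv_cst.
apply: eq_bigr => h _; rewrite Rintegral_bounded_sum//.
rewrite RintegralZl//; last exact: bounded_rv_integrable.
rewrite Rintegral_indic; last exact: measurable_history.
rewrite /f' -mulrA mulr_suml mulr_sumr; apply: eq_bigr => y _.
rewrite RintegralZl//; last by apply: bounded_rv_integrable; exact: bounded_rv_indic.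
rewrite Rintegral_indic// [P (A h y)]Pstep fineM ?fin_num_measure//=; last first.
  exact: measurable_history.
rewrite /action history_nth -tnth_history history_nth /F.
ring.
Qed.

End expectation.

(** * The discounted reward and its exponential moments *)

Section discounted.
Variables (R : realType) (k l : nat) (M : mdp R k l) (beta : R).
Hypothesis beta01 : 0 < beta < 1.
Implicit Types (x y : 'I_k.+1) (a : 'I_l.+1) (pi : policy k l).
Implicit Types (gamma : R) (n : nat) (w : trajectory k) (g : 'I_k.+1 -> R).

Local Notation Z pi w := (discounted_reward M beta pi w).

Let beta_gt0 : 0 < beta. Proof. by case/andP: beta01. Qed.

Let beta_lt1 : `|beta| < 1.
Proof. by rewrite gtr0_norm//; case/andP: beta01. Qed.

Definition partial_reward pi n w : R :=
  series (fun i => beta ^+ i * reward M (w i) (action pi w i)) n.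

Definition reward_bound : R := \sum_x \sum_a `|reward M x a|.

Definition return_bound : R := reward_bound / (1 - beta).

Lemma reward_le x a : `|reward M x a| <= reward_bound.
Proof.
rewrite /reward_bound (bigD1 x)//= (bigD1 a)//= -addrA lerDl.
by rewrite addr_ge0// ?sumr_ge0// => y _; rewrite sumr_ge0.
Qed.

Lemma return_bound_ge0 : 0 <= return_bound.
Proof.
rewrite divr_ge0 ?(le_trans _ (reward_le ord0 ord0))//.
by rewrite subr_ge0; case/andP: beta01 => _ /ltW.
Qed.

(** The rewards after time n contribute at most
    C beta^n + C beta^(n+1) + ... = C beta^n / (1 - beta). *)
Lemma return_tail pi n w :
  `|Z pi w - partial_reward pi n w| <= return_bound * beta ^+ n.
Proof.
have b1 : beta != 1 by rewrite lt_eqF//; case/andP: beta01.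
have C0 : 0 <= reward_bound := le_trans (normr_ge0 _) (reward_le ord0 ord0).
have term i : `|beta ^+ i * reward M (w i) (action pi w i)| <=
    geometric reward_bound beta i.
  rewrite /= normrM normrX gtr0_norm// mulrC ler_wpM2r ?reward_le//.
  exact/exprn_ge0/ltW.
apply: lim_series_dist_le => [|m nm].
  apply: normed_cvg.
  apply: (@series_le_cvg _ _ (geometric reward_bound beta)).
  - by move=> i; exact: normr_ge0.
  - by move=> i; apply: geometric_ge0 => //; exact: ltW.
  - exact: term.
  - exact: is_cvg_geometric_series.
apply: le_trans (ler_norm_sum _ _ _) _.
apply: le_trans (ler_sum _ (fun i _ => term i)) _.
rewrite -sub_series_geq// !geometric_seriesE//= -mulrBl -mulrBr.
rewrite /return_bound [leRHS]mulrAC ler_wpM2r ?invr_ge0 ?subr_ge0//.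
  by case/andP: beta01 => _ /ltW.
by rewrite ler_wpM2l//; have := exprn_ge0 m (ltW beta_gt0); lra.
Qed.

Lemma return_le pi w : `|Z pi w| <= return_bound.
Proof.
have := return_tail pi 0 w.
by rewrite /partial_reward /series/= big_geq// subr0 mulr1.
Qed.

Lemma adapted_partial_reward pi n : adapted n (partial_reward pi n).
Proof.
move=> w w' ww'; rewrite /partial_reward /series/=.
apply: eq_big_nat => i /andP[_ ni]; congr (_ * _); congr reward.
  exact/ww'/ltnW.
by apply: adapted_action => j ji; apply: ww'; rewrite (leq_trans ji)// ltnW.
Qed.

Lemma adapted_partial_rewardS pi n : adapted n (partial_reward pi n.+1).
Proof.
move=> w w' ww'; rewrite /partial_reward !seriesSr.
rewrite -!/(partial_reward pi n _) (adapted_partial_reward pi ww').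
by rewrite (adapted_action pi ww') ww'.
Qed.

Lemma bounded_rv_return pi : bounded_rv (discounted_reward M beta pi).
Proof.
split; last by exists return_bound; exact: return_le.
apply: (@measurable_fun_cvg _ _ _ _ (partial_reward pi)) => [n|w _].
  by have [] := bounded_rv_adapted (@adapted_partial_reward pi n).
apply/cvgrPdist_le => e e0; near=> n; apply: le_trans (return_tail pi n w) _.
suff : `|0 - geometric return_bound beta n| <= e.
  by rewrite sub0r normrN; apply: le_trans; exact: ler_norm.
near: n; move: e e0; apply/cvgrPdist_le; exact: cvg_geometric.
Unshelve. all: by end_near. Qed.

Definition mgf gamma x pi : R :=
  expect M x pi (fun w => expR (gamma * Z pi w)).

(** The right-hand side of the risk-sensitive optimality equation, for action a
    in state x and continuation g. *)
Definition bellman gamma a x g : R :=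
  expR (gamma * reward M x a) * \sum_y trans M a x y * g y.

Definition finite_mgf gamma x pi n g : R :=
  expect M x pi (fun w => expR (gamma * partial_reward pi n w) * g (w n)).

Lemma bounded_rv_mgf gamma pi : bounded_rv (fun w => expR (gamma * Z pi w)).
Proof.
apply: bounded_rv_expR; apply: bounded_rvM; first exact: bounded_rv_cst.
exact: bounded_rv_return.
Qed.

Lemma bounded_rv_finite_mgf gamma pi n (f : trajectory k -> R) : adapted n f ->
  bounded_rv (fun w => expR (gamma * partial_reward pi n w) * f w).
Proof.
move=> fn; apply: (@bounded_rv_adapted _ _ n).
move=> w w' ww'; rewrite (fn _ _ ww').
by rewrite (adapted_partial_reward pi ww').
Qed.

Lemma finite_mgfS gamma x pi n g :
  finite_mgf gamma x pi n.+1 g =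
  expect M x pi (fun w => expR (gamma * partial_reward pi n w) *
    bellman (gamma * beta ^+ n) (action pi w n) (w n) g).
Proof.
rewrite /finite_mgf (@expect_step _ _ _ M x pi n
  (fun w => expR (gamma * partial_reward pi n.+1 w))).
  congr expect; apply/funext => w.
  rewrite {1}/partial_reward seriesSr -/(partial_reward pi n w).
  by rewrite mulrDr expRD mulrA -mulrA.
move=> w w' ww'; congr (expR (_ * _)); exact: adapted_partial_rewardS.
Qed.

(** The forward recursion [expect_step] peels off the last transition; this
    peels off the first one. Induction on the horizon, with the terminal function
    g generalised to absorb the last transition, exchanges the two. *)
Lemma finite_mgf_markov (v : nat -> 'I_k.+1 -> 'I_l.+1) n gamma x g :
  finite_mgf gamma x (Defs.markov v) n.+1 g =
  bellman gamma (v 0%N x) x (fun y =>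
    finite_mgf (gamma * beta) y (Defs.markov (fun m => v m.+1)) n g).
Proof.
have fm0 c y pi h : finite_mgf c y pi 0 h = h y.
  rewrite -[RHS](expect_initial M y pi); congr expect; apply/funext => w.
  by rewrite /partial_reward /series/= big_geq// mulr0 expR0 mul1r.
have fmS (v' : nat -> 'I_k.+1 -> 'I_l.+1) m c y h :
    finite_mgf c y (Defs.markov v') m.+1 h =
    finite_mgf c y (Defs.markov v') m
      (fun z => bellman (c * beta ^+ m) (v' m z) z h).
  rewrite finite_mgfS; congr expect; apply/funext => w.
  by rewrite /action /Defs.markov tnth_history.
elim: n g => [|n IH] g.
  rewrite fmS fm0 mulr1; congr bellman; apply/funext => y.
  by rewrite fm0.
rewrite fmS IH; congr bellman; apply/funext => y.
by rewrite [RHS]fmS exprS mulrA.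
Qed.

Let return_error gamma n := `|gamma| * (return_bound * beta ^+ n).

Lemma exp_return_le gamma pi n w :
  expR (gamma * Z pi w) <=
  expR (gamma * partial_reward pi n w) * expR (return_error gamma n).
Proof.
rewrite -expRD ler_expR -lerBlDl -mulrBr.
by rewrite (le_trans (ler_norm _))// normrM ler_wpM2l// return_tail.
Qed.

Lemma exp_return_ge gamma pi n w :
  expR (gamma * partial_reward pi n w) <=
  expR (gamma * Z pi w) * expR (return_error gamma n).
Proof.
rewrite -expRD ler_expR -lerBlDl -mulrBr.
by rewrite (le_trans (ler_norm _))// normrM ler_wpM2l// distrC return_tail.
Qed.

Lemma cvg_exp_error c gamma :
  (fun n => expR (c * return_error gamma n)) @ \oo --> (1 : R).
Proof.
rewrite -(expR0 R); apply: continuous_cvg; first exact: continuous_expR.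
rewrite (_ : (fun n => _) = geometric (c * (`|gamma| * return_bound)) beta).
  exact: cvg_geometric.
by apply/funext => n; rewrite /return_error /= !mulrA.
Qed.

(** The error is multiplicative: exp(gamma Z) and exp(gamma Z_n) differ by a
    factor between exp(-r_n) and exp(r_n), where r_n tends to 0 uniformly in the
    trajectory, so no convergence theorem for integrals is needed. *)
Lemma mgf_cvg gamma x pi :
  (fun n => finite_mgf gamma x pi n (fun=> 1)) @ \oo --> mgf gamma x pi.
Proof.
have bZ := bounded_rv_mgf gamma pi.
have bF n : bounded_rv (fun w => expR (gamma * partial_reward pi n w)).
  apply: bounded_rv_expR; apply: bounded_rvM; first exact: bounded_rv_cst.
  exact: bounded_rv_adapted (@adapted_partial_reward pi n).
have fmE n : finite_mgf gamma x pi n (fun=> 1) =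
    \int[law M x pi]_w expR (gamma * partial_reward pi n w).
  by rewrite -expectE; congr expect; apply/funext => w; rewrite mulr1.
have bM f r : bounded_rv f -> bounded_rv (fun w : trajectory k => f w * r : R).
  by move=> bf; apply: bounded_rvM => //; exact: bounded_rv_cst.
apply: (@squeeze_cvgr _ _ _ _
  (fun n => expR (- 1 * return_error gamma n) * mgf gamma x pi)
  (fun n => expR (1 * return_error gamma n) * mgf gamma x pi)).
- near=> n; rewrite fmE /mgf expectE !mulN1r !mul1r expRN; apply/andP; split.
    rewrite ler_pdivrMl ?expR_gt0// mulrC -RintegralZr//; last first.
      exact: bounded_rv_integrable.
    by apply: ler_Rintegral => // [|w]; [exact: bM|exact: exp_return_le].
  rewrite mulrC -RintegralZr//; last exact: bounded_rv_integrable.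
  by apply: ler_Rintegral => // [|w]; [exact: bM|exact: exp_return_ge].
- rewrite -[X in _ --> X]mul1r; apply: cvgM; last exact: cvg_cst.
  exact: cvg_exp_error.
- rewrite -[X in _ --> X]mul1r; apply: cvgM; last exact: cvg_cst.
  exact: cvg_exp_error.
Unshelve. all: by end_near. Qed.

(** First-step equation: the reward collected after time 0 is beta times the
    discounted reward of the shifted policy, so the continuation has parameter
    gamma beta instead of gamma. *)
Lemma mgf_markov (v : nat -> 'I_k.+1 -> 'I_l.+1) gamma x :
  mgf gamma x (Defs.markov v) =
  bellman gamma (v 0%N x) x (fun y => mgf (gamma * beta) y (Defs.markov (fun m => v m.+1))).
Proof.
have := @mgf_cvg gamma x (Defs.markov v); rewrite -cvg_shiftS => /cvg_lim <-//.
apply: cvg_lim => //; under eq_fun do rewrite finite_mgf_markov.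
apply: cvgM; first exact: cvg_cst.
apply: cvg_big => [|y _]; first exact: add_continuous.
 apply: cvgM; first exact: cvg_cst.
exact: mgf_cvg.
Qed.

Lemma mgf_le_exp gamma x pi : mgf gamma x pi <= expR (`|gamma| * return_bound).
Proof.
rewrite /mgf expectE -[leRHS](Rintegral_probability_cst (law M x pi)).
apply: ler_Rintegral => [||w]; first exact: bounded_rv_mgf.
  exact: bounded_rv_cst.
by rewrite ler_expR (le_trans (ler_norm _))// normrM ler_wpM2l// return_le.
Qed.

Lemma mgf_gt0 gamma x pi : 0 < mgf gamma x pi.
Proof.
apply: lt_le_trans (expR_gt0 (- (`|gamma| * return_bound))) _.
rewrite /mgf expectE -[leLHS](Rintegral_probability_cst (law M x pi)).
apply: ler_Rintegral => [||w]; first exact: bounded_rv_cst.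
  exact: bounded_rv_mgf.
by rewrite ler_expR lerNl (le_trans (ler_norm _))// normrN normrM ler_wpM2l// return_le.
Qed.

(** Verification: by [expect_step] the hypothesis makes
    n |-> E[exp(gamma Z_n) phi_(gamma beta^n)(X_n)] nondecreasing, for every,
    possibly history-dependent, policy. Its value at 0 is phi_gamma(x), and its
    limit is the exponential moment of the policy since phi_(gamma beta^n) tends
    to 1 uniformly. *)
Lemma bellman_verification (u : 'I_k.+1 -> 'I_l.+1) gamma :
  (forall n x a, mgf (gamma * beta ^+ n) x (stationary u) <=
    bellman (gamma * beta ^+ n) a x
      (fun y => mgf (gamma * beta ^+ n.+1) y (stationary u))) ->
  forall x pi, mgf gamma x (stationary u) <= mgf gamma x pi.
Proof.
move=> Hu x pi; pose V n y := mgf (gamma * beta ^+ n) y (stationary u).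
have V_le n : V 0%N x <= finite_mgf gamma x pi n (V n).
  elim: n => [|n IH].
    rewrite -{1}(expect_initial M x pi (V 0%N)) le_eqVlt; apply/predU1P; left.
    congr expect; apply/funext => w.
    by rewrite /partial_reward /series/= big_geq// mulr0 expR0 mul1r.
  apply: le_trans IH _; rewrite finite_mgfS /finite_mgf !expectE.
  apply: ler_Rintegral => [||w].
  - by apply: bounded_rv_finite_mgf; exact: adapted_coordinate.
  - apply: bounded_rv_finite_mgf => w w' ww'.
    by rewrite (adapted_action pi ww') ww'.
  - by rewrite ler_wpM2l ?expR_ge0//; exact: Hu.
have {}V_le n : V 0%N x <= expR (2 * return_error gamma n) * mgf gamma x pi.
  apply: le_trans (V_le n) _; rewrite /finite_mgf /mgf !expectE -RintegralZl//.
    apply: ler_Rintegral => [||w].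
    - by apply: bounded_rv_finite_mgf; exact: adapted_coordinate.
    - by apply: bounded_rvM; [exact: bounded_rv_cst|exact: bounded_rv_mgf].
    (* One factor exp(r_n) is for truncating Z, the other for the distance of
       V n from 1. *)
    have V_err : V n (w n) <= expR (return_error gamma n).
      apply: le_trans (mgf_le_exp _ _ _) _; rewrite ler_expR normrM normrX.
      by rewrite (gtr0_norm beta_gt0) -mulrA (mulrC (beta ^+ n)).
    have V_ge0 : 0 <= V n (w n) by rewrite ltW// mgf_gt0.
    rewrite mulr_natl mulr2n expRD [leRHS]mulrC mulrA.
    by apply: ler_pM => //; exact: exp_return_ge.
  exact/bounded_rv_integrable/bounded_rv_mgf.
rewrite -(mulr1 gamma) -/(V 0%N x) -[leRHS]mul1r.
have cv : (fun n => expR (2 * return_error gamma n) * mgf gamma x pi) @ \oo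
    --> 1 * mgf gamma x pi.
  by apply: cvgM; [exact: cvg_exp_error|exact: cvg_cst].
rewrite mulr1 -(cvg_lim _ cv)//; apply: limr_ge; first exact: cvgP cv.
by near=> n; exact: V_le.
Unshelve. all: by end_near. Qed.

(** Taylor's expansion of exp(gamma Z), uniform in the trajectory, and
    integrated. *)
Lemma mgf_taylor gamma x pi n :
  `|mgf gamma x pi - \sum_(0 <= j < n) gamma ^+ j / j`!%:R * moment M beta x pi j|
  <= (`|gamma| * return_bound) ^+ n * expR (`|gamma| * return_bound).
Proof.
have bX j : bounded_rv (fun w => gamma ^+ j / j`!%:R * Z pi w ^+ j).
  apply: bounded_rvM; first exact: bounded_rv_cst.
  exact/bounded_rvX/bounded_rv_return.
have -> : \sum_(0 <= j < n) gamma ^+ j / j`!%:R * moment M beta x pi j =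
    \int[law M x pi]_w
      (\sum_(0 <= j < n) gamma ^+ j / j`!%:R * Z pi w ^+ j).
  rewrite Rintegral_bounded_sum//; apply: eq_bigr => j _.
  rewrite RintegralZl ?expectE//; last first.
    exact/bounded_rv_integrable/bounded_rvX/bounded_rv_return.
  by rewrite /moment expectE.
rewrite /mgf expectE; apply: Rintegral_dist_le => [||w].
- exact: bounded_rv_mgf.
- exact: bounded_rv_sum.
have gZ : `|gamma * Z pi w| <= `|gamma| * return_bound.
  by rewrite normrM ler_wpM2l// return_le.
rewrite (eq_bigr (fun j => (gamma * Z pi w) ^+ j / j`!%:R)); last first.
  by move=> j _; rewrite exprMn mulrAC.
apply: le_trans (expR_taylor _ _) _.
rewrite ler_pM ?exprn_ge0 ?expR_ge0 ?ler_expR//.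
by rewrite lerXn2r// nnegrE// (le_trans _ gZ).
Qed.

End discounted.

(** * Comparing exponential moments near zero *)

Lemma uniform_left_neighborhood (R : realType) (I : finType) (Q : I -> R -> Prop) :
  (forall i, exists2 e : R, 0 < e & forall gamma, - e <= gamma < 0 -> Q i gamma) ->
  exists2 e : R, 0 < e & forall gamma, - e <= gamma < 0 -> forall i, Q i gamma.
Proof.
move=> /(_ _)/cid2-/all_sig2[e e_gt0 Qe].
exists (\big[Num.min/1]_i e i) => [|gamma /andP[eg g0] i].
  by apply/bigmin_gtP; split.
apply: Qe; rewrite g0 andbT (le_trans _ eg)// lerN2.
exact: bigmin_le_cond.
Qed.

Section comparison.
Variables (R : realType) (k l : nat) (M : mdp R k l) (beta : R).
Hypothesis beta01 : 0 < beta < 1.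
Variables (x : 'I_k.+1) (pi pi' : policy k l).

Local Notation m j := (moment M beta x pi j).
Local Notation m' j := (moment M beta x pi' j).
Local Notation B := (return_bound M beta).

Lemma moment0 rho : moment M beta x rho 0 = 1.
Proof. by rewrite /moment expectE Rintegral_probability_cst. Qed.

Lemma mgf_diff_taylor gamma n :
  (forall j, (1 <= j < n)%N -> m j = m' j) ->
  `|mgf M beta gamma x pi - mgf M beta gamma x pi'
    - gamma ^+ n / n`!%:R * (m n - m' n)|
  <= 2 * ((`|gamma| * B) ^+ n.+1 * expR (`|gamma| * B)).
Proof.
move=> mm'; have := mgf_taylor M beta01 gamma x pi n.+1.
have := mgf_taylor M beta01 gamma x pi' n.+1.
rewrite !big_nat_recr//=.
have -> : \sum_(0 <= j < n) gamma ^+ j / j`!%:R * m j =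
          \sum_(0 <= j < n) gamma ^+ j / j`!%:R * m' j.
  apply: eq_big_nat => -[_|j jn]; first by rewrite !moment0.
  by rewrite mm'.
rewrite !ler_norml; lra.
Qed.

(** On [-1/(B + 1), 0) one has |gamma| B < 1, so the Taylor error tends to 0
    with the order of the expansion. *)
Lemma mgf_eq_near0 : (forall j, (1 <= j)%N -> m j = m' j) ->
  exists2 e : R, 0 < e & forall gamma, - e <= gamma < 0 ->
    mgf M beta gamma x pi = mgf M beta gamma x pi'.
Proof.
move=> mm'; have B0 := return_bound_ge0 M beta01.
exists (B + 1)^-1 => [|gamma /andP[eg g0]]; first by rewrite invr_gt0; lra.
have q1 : `|gamma| * B < 1.
  rewrite ltr0_norm//; have : - gamma * (B + 1) <= 1.
    by rewrite -ler_pdivlMr ?div1r 1?lerNl// ltr_wpDl.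
  by rewrite mulrDr mulr1; lra.
apply/eqP; rewrite -subr_eq0 -normr_eq0 eq_le normr_ge0 andbT.
have bound n : `|mgf M beta gamma x pi - mgf M beta gamma x pi'| <=
    geometric (2 * expR (`|gamma| * B) * (`|gamma| * B)) (`|gamma| * B) n.
  have := @mgf_diff_taylor gamma n.
  have -> : m n = m' n by case: n => [|n]; [rewrite !moment0|exact: mm'].
  rewrite subrr mulr0 subr0 => bound_n.
  apply: le_trans (bound_n _) _ => [j /andP[j1 _]|]; first exact: mm'.
  by rewrite /= exprS le_eqVlt; apply/predU1P; left; ring.
have cv : geometric (2 * expR (`|gamma| * B) * (`|gamma| * B)) (`|gamma| * B)
    @ \oo --> (0 : R).
  by apply: cvg_geometric; rewrite ger0_norm// mulr_ge0.
rewrite -(cvg_lim _ cv)//; apply: limr_ge; first exact: cvgP cv.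
by near=> n; exact: bound.
Unshelve. all: by end_near. Qed.

(** With gamma = -t, the leading term of the difference is
    - t^n (-1)^(n+1) (m n - m' n) / n!, and the error is O(t^(n+1)). *)
Lemma mgf_lt_near0 n :
  (forall j, (1 <= j < n)%N -> m j = m' j) ->
  (-1) ^+ n.+1 * m' n < (-1) ^+ n.+1 * m n ->
  exists2 e : R, 0 < e & forall gamma, - e <= gamma < 0 ->
    mgf M beta gamma x pi < mgf M beta gamma x pi'.
Proof.
move=> mm' mn; have B0 := return_bound_ge0 M beta01.
pose delta := (-1) ^+ n.+1 * (m n - m' n) / n`!%:R.
have delta_gt0 : 0 < delta.
  by rewrite divr_gt0 ?ltr0n ?fact_gt0// mulrBr subr_gt0.
pose K := 2 * (B ^+ n.+1 * expR B).
have K0 : 0 <= K by rewrite !mulr_ge0 ?exprn_ge0 ?expR_ge0.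
(* t <= 1 bounds the Taylor error by K t^(n+1), and the other bound makes this
   smaller than delta t^n; the 1 in K + 1 keeps the quotient defined and the
   inequality strict when B = 0. *)
exists (Num.min 1 (delta / (K + 1))) => [|gamma].
  by rewrite lt_min ltr01 divr_gt0// ltr_wpDl.
move=> /andP[eg g0].
pose t := - gamma; have t0 : 0 < t by rewrite oppr_gt0.
have [t1 td] : t <= 1 /\ t <= delta / (K + 1).
  by apply/andP; rewrite -le_min /t lerNl.
have tK : t * K < delta.
  rewrite ler_pdivlMr in td; last by rewrite ltr_wpDl.
  by apply: lt_le_trans td; rewrite ltr_pM2l// ltrDl.
have := @mgf_diff_taylor gamma n mm'.
have -> : gamma ^+ n / n`!%:R * (m n - m' n) = - (t ^+ n * delta).
  rewrite /delta -[gamma]opprK -/t (exprNn t) exprS; ring.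
have -> : `|gamma| = t by rewrite ltr0_norm.
have err : 2 * ((t * B) ^+ n.+1 * expR (t * B)) < t ^+ n * delta.
  apply: le_lt_trans (_ : t ^+ n * (t * K) < _); last first.
    by rewrite ltr_pM2l// exprn_gt0.
  rewrite exprMn exprSr /K.
  have -> : t ^+ n * (t * (2 * (B ^+ n.+1 * expR B))) =
    2 * (t ^+ n * t * B ^+ n.+1 * expR B) by ring.
  rewrite ler_wpM2l// ler_wpM2l ?mulr_ge0 ?exprn_ge0 ?(ltW t0)//.
  by rewrite ler_expR ler_piMl.
rewrite ler_norml; lra.
Qed.

End comparison.

(** * Optimality in terms of exponential moments *)

Lemma optimal_markov_stationary (R : realType) (k l : nat) (M : mdp R k l)
    (beta gamma : R) (u : 'I_k.+1 -> 'I_l.+1) :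
  optimal_markov M beta gamma (stationary u) <->
  forall (pi : policy k l) x, J M gamma x pi beta <= J M gamma x (stationary u) beta.
Proof.
split=> [[_ Ju] pi x|Ju].
  by rewrite -lee_fin Ju; apply: ereal_sup_ubound; exists pi.
split=> [|x]; first by exists (fun=> u).
apply/eqP; rewrite eq_le; apply/andP; split.
  by apply: ereal_sup_ubound; exists (stationary u).
by apply: ge_ereal_sup => _ [pi _ <-]; rewrite lee_fin.
Qed.

Lemma le_J_neg (R : realType) (k l : nat) (M : mdp R k l) (beta gamma : R) x
    (pi pi' : policy k l) : 0 < beta < 1 -> gamma < 0 ->
  (J M gamma x pi' beta <= J M gamma x pi beta) =
  (mgf M beta gamma x pi <= mgf M beta gamma x pi').
Proof.
move=> beta01 g0; rewrite /J lt_eqF// ler_nM2l ?invr_lt0// ler_ln//;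
  by rewrite posrE mgf_gt0.
Qed.

Lemma J0 (R : realType) (k l : nat) (M : mdp R k l) (beta : R) x
    (pi : policy k l) : J M 0 x pi beta = moment M beta x pi 1.
Proof. by rewrite /J eqxx. Qed.

Theorem proposition6p7 (R : realType) (k l : nat) (M : mdp R k l)
    (beta : R) (beta01 : 0 < beta < 1) (u : 'I_k.+1 -> 'I_l.+1) :
  moment_optimal M beta (stationary u) <->
  exists2 gamma_beta : R, gamma_beta < 0 &
    forall gamma : R, gamma_beta <= gamma <= 0 ->
      optimal_markov M beta gamma (stationary u).
Proof.
have /andP[beta_gt0 /ltW beta_le1] := beta01.
have signN0 n : (-1) ^+ n != 0 :> R by rewrite signr_eq0.
split=> [opt|[g0 g0_lt0 opt] pi x].
(* Only the one-step deviations from u are compared with u by moments; the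
   verification lemma extends the comparison to all policies. *)
- pose deviation (a : 'I_l.+1) : policy k l :=
    Defs.markov (fun n => if n is 0 then fun=> a else u).
  have [e e_gt0 He] : exists2 e : R, 0 < e & forall gamma, - e <= gamma < 0 ->
      forall xa : 'I_k.+1 * 'I_l.+1,
      mgf M beta gamma xa.1 (stationary u) <=
      mgf M beta gamma xa.1 (deviation xa.2).
    apply: uniform_left_neighborhood => -[x a] /=.
    have [/(mgf_eq_near0 beta01)[e e0 He]|[n [_ eqn ltn]]] := opt (deviation a) x.
      by exists e => // gamma /He ->.
    have [|e e0 He] := mgf_lt_near0 beta01 _ ltn.
      move=> j /eqn; apply: mulfI; exact: signN0.
    by exists e => // gamma /He/ltW.
  exists (- e); first by rewrite oppr_lt0.
  move=> gamma /andP[eg]; rewrite le_eqVlt => /predU1P[->|g_lt0].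
    apply/optimal_markov_stationary => pi x; rewrite !J0.
    have sqr1 : (-1) ^+ 2 = 1 :> R by rewrite sqrrN expr1n.
    have [->//|[[|[|n]] [// _ eqn ltn]]] := opt pi x.
      by apply: ltW; rewrite sqr1 !mul1r in ltn.
    by have := eqn 1%N isT; rewrite sqr1 !mul1r => ->.
  apply/optimal_markov_stationary => pi x; rewrite le_J_neg//.
  apply: bellman_verification => // n y a.
  have gn : - e <= gamma * beta ^+ n < 0.
    rewrite nmulr_rlt0// exprn_gt0// andbT (le_trans eg)//.
    by rewrite -[leLHS]mulr1 ler_wnM2l ?(ltW g_lt0)// exprn_ile1// ltW.
  apply: le_trans (He _ gn (y, a)) _.
  by rewrite /= /deviation mgf_markov//= exprSr mulrA.
have [eqm|/existsNP[n0 /not_implyP[n0_gt0 neq0]]] :=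
    pselect (forall j, (1 <= j)%N ->
      moment M beta x (stationary u) j = moment M beta x pi j); first by left.
right.
have ex : exists n, (1 <= n)%N &&
    (moment M beta x (stationary u) n != moment M beta x pi n).
  by exists n0; rewrite n0_gt0; apply/eqP.
case: (ex_minnP ex) => n /andP[n_gt0 neqn] minn.
have eqn j : (1 <= j < n)%N ->
    moment M beta x (stationary u) j = moment M beta x pi j.
  move=> /andP[j1 jn]; apply/eqP; apply/negPn/negP => neqj.
  by have := minn j; rewrite j1 neqj leqNgt jn => /(_ isT).
exists n; split=> // [j /eqn ->//|].
rewrite lt_neqAle (inj_eq (mulfI (signN0 _))) eq_sym neqn/= leNgt.
apply/negP => ltn.
have [|e e_gt0 He] := mgf_lt_near0 beta01 _ ltn.
  by move=> j /eqn.
(* The first differing moment is not in favour of pi: otherwise pi would have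
   the smaller exponential moment at this gamma, where u is optimal. *)
pose gamma := Num.max (- e) g0.
have gamma_lt0 : gamma < 0 by rewrite gt_max oppr_lt0 e_gt0.
have /optimal_markov_stationary/(_ pi x) : optimal_markov M beta gamma (stationary u).
  by apply: opt; rewrite le_max lexx orbT ltW.
rewrite le_J_neg// leNgt He//.
by rewrite le_max lexx.
Qed.
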